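(* Let $n\ge 2$, $1\le t\le n-1$, $T=3^t$. Let $C$ be the ternary code of length $3^n$ with parity check matrix $H_{n,t}$, let $\mathcal{D}$ be the triple system on $V=\{1,\dots,3^n\}$ whose blocks are the supports of all weight-$3$ codewords of $C$ with all nonzero entries equal to $1$, and for $u\in\mathrm{GF}(3)^{n-t}$ let $G_u$ be the set of indices $i$ such that the $i$-th column of $B_{n,t}$ equals $u$. Let $\mathcal{S}$ be any Steiner triple system on $V$ all of whose blocks are blocks of $\mathcal{D}$, with block set $\mathcal{B}$. Then $\mathcal{B}$ is the disjoint union of: (1) for each $u\in\mathrm{GF}(3)^{n-t}$, a set $\mathcal{B}_u$ of $T(T-1)/6$ blocks such that $(G_u,\mathcal{B}_u)$ is a Steiner triple system on $G_u$; (2) for each line $\ell=\{a,b,c\}$ of the affine geometry $AG(n-t,3)$, a set $\mathcal{B}_\ell$ of $T^2=3^{2t}$ blocks forming a transversal design $TD[3;T]$ on the three groups $G_a,G_b,G_c$.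
   Context: $B_{n,t}$ is the $(n-t)\times 3^n$ ternary matrix obtained by deleting $t$ rows from an $n\times 3^n$ matrix whose columns are all distinct vectors of $\mathrm{GF}(3)^n$; its columns consist of each vector of $\mathrm{GF}(3)^{n-t}$ exactly $3^t$ times. $H_{n,t}$ is the matrix with first row the all-one vector and remaining rows those of $B_{n,t}$, and $C=\{c\in\mathrm{GF}(3)^{3^n}:H_{n,t}c^T=0\}$. The points of $AG(n-t,3)$ are the vectors of $\mathrm{GF}(3)^{n-t}$ and its lines are the triples $\{a,b,c\}$ of distinct vectors with $a+b+c=0$. A Steiner triple system on $V$ is a set of $3$-subsets such that every $2$-subset of $V$ lies in exactly one of them. A transversal design $TD[3;g]$ on three disjoint groups of size $g$ is a set of $3$-subsets each meeting every group in one point such that any two points from different groups lie in exactly one of them. *)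

(* Defs.v *)
From HB Require Import structures.
From mathcomp Require Import all_boot all_order all_algebra.

Set Implicit Arguments.
Unset Strict Implicit.
Unset Printing Implicit Defensive.

Import GRing.Theory.
Local Open Scope ring_scope.

(* The points 1, ..., 3^n are represented by 'I_(3 ^ n) (numbered from 0), and
   the vectors of GF(3)^m by columns 'cV['F_3]_m. *)

Definition lists_all_vectors (n : nat) (A : 'M['F_3]_(n, 3 ^ n)) : Prop :=
  bijective (fun j => col j A).

(* The strictly increasing f enumerates the n - t rows that are kept. *)
Definition is_B_matrix (n t : nat) (B : 'M['F_3]_(n - t, 3 ^ n)) : Prop :=
  exists (A : 'M['F_3]_(n, 3 ^ n)) (f : 'I_(n - t) -> 'I_n),
    [/\ lists_all_vectors A,
        {homo f : i j / (i < j)%N}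
      & B = rowsub f A].

Definition H_matrix (m N : nat) (B : 'M['F_3]_(m, N)) : 'M['F_3]_(1 + m, N) :=
  col_mx (const_mx 1) B.

Definition code (r N : nat) (H : 'M['F_3]_(r, N)) : {set 'rV['F_3]_N} :=
  [set c | H *m c^T == 0].

Definition supp (N : nat) (c : 'rV['F_3]_N) : {set 'I_N} :=
  [set i | c 0 i != 0].

Definition weight (N : nat) (c : 'rV['F_3]_N) : nat := #|supp c|.

Definition code_triples (N : nat) (C : {set 'rV['F_3]_N}) : {set {set 'I_N}} :=
  [set supp c | c in C & (weight c == 3) && [forall i in supp c, c 0 i == 1]].

Definition point_group (m N : nat) (B : 'M['F_3]_(m, N)) (u : 'cV['F_3]_m) :
  {set 'I_N} := [set i | col i B == u].

Definition AG_lines (m : nat) : {set {set 'cV['F_3]_m}} :=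
  [set l | [exists a, exists b, exists c,
     [&& l == [set a; b; c], uniq [:: a; b; c] & a + b + c == 0]]].

Definition steiner_triple_system (V : finType) (X : {set V})
    (Bs : {set {set V}}) : Prop :=
  (forall b, b \in Bs -> b \subset X /\ #|b| = 3%N) /\
  (forall P : {set V}, P \subset X -> #|P| = 2%N ->
     #|[set b in Bs | P \subset b]| = 1%N).

(* TD[3; g] whose set of groups is Gs. *)
Definition transversal_design3 (V : finType) (g : nat) (Gs : {set {set V}})
    (Bs : {set {set V}}) : Prop :=
  [/\ #|Gs| = 3%N /\ trivIset Gs,
      forall G, G \in Gs -> #|G| = g,
      forall b, b \in Bs ->
        #|b| = 3%N /\ (forall G, G \in Gs -> #|b :&: G| = 1%N)
    & forall G G' x y, G \in Gs -> G' \in Gs -> G != G' ->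
        x \in G -> y \in G' ->
        #|[set b in Bs | (x \in b) && (y \in b)]| = 1%N].

(* Main.v *)
(* Every weight-3 codeword with nonzero entries 1 is the indicator of a triple
   whose three columns in B add up to 0.  Over GF(3), three vectors with sum 0
   are either all equal or the three points of a line, and two of them determine
   the third.  Hence the unique block through two points of the same group G_u
   stays in G_u, while the unique block through points of G_u and G_v with u <> v
   meets the three groups indexed by the line through u and v in one point each.
   The block counts follow by double counting pairs of points. *)

Require Import Defs.
From HB Require Import structures.
From mathcomp Require Import all_boot all_order all_algebra.

Set Implicit Arguments.
Unset Strict Implicit.
Unset Printing Implicit Defensive.

Import GRing.Theory.

Lemma F3_col_add3 m (u : 'cV['F_3]_m) : (u + u + u = 0)%R.
Proof.
apply/matrixP=> i j; rewrite !mxE -mulr2n -mulrSr -mulr_natr.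
by rewrite (_ : 3%:R = 0)%R ?mulr0 //; apply/val_inj.
Qed.

(** The third point of a zero-sum triple through [u] and [v] is [- (u + v)]; by [3u = 0] it
    collapses to [u] when [v = u]. *)
Lemma F3_col_oppD m (u : 'cV['F_3]_m) : (- (u + u) = u)%R.
Proof. by apply/eqP; rewrite eq_sym -addr_eq0 addrA F3_col_add3. Qed.

Lemma cards3_third (T : finType) (b : {set T}) x y :
  #|b| = 3 -> x \in b -> y \in b -> x != y ->
  exists k, [/\ b = [set x; y; k], k != x & k != y].
Proof.
move=> b3 xb yb nxy.
have /cards1P[k /setP hk] : #|b :\ x :\ y| == 1.
  move: b3; rewrite (cardsD1 x) xb (cardsD1 y) !inE eq_sym nxy yb.
  by case=> c1; apply/eqP.
exists k.
have := hk k; rewrite !inE eqxx => /and3P[ky kx kb].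
split=> //; apply/setP=> z; have := hk z; rewrite !inE => <-.
by case: eqVneq => [->|_] //=; case: eqVneq => [->|].
Qed.

Lemma AG_line_card m (l : {set 'cV['F_3]_m}) : l \in AG_lines m -> #|l| = 3.
Proof.
rewrite inE => /existsP[a /existsP[b /existsP[c /and3P[/eqP -> + _]]]].
rewrite /= !inE !andbT => /andP[/norP[ab ac] bc].
by rewrite -setUA cardsU1 cards2 !inE negb_or ab ac bc.
Qed.

(** The sum over the set [l] is 0 whatever order its points are named in, so it can be expanded
    along [u], [v] and the remaining point [k]. *)
Lemma AG_line_third m (l : {set 'cV['F_3]_m}) u v :
  l \in AG_lines m -> u \in l -> v \in l -> u != v ->
  l = [set u; v; (- (u + v))%R].
Proof.
move=> hl ul vl nuv.
have [k [lE ku kv]] := cards3_third (AG_line_card hl) ul vl nuv.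
suff -> : (- (u + v) = k)%R by [].
have suml : (\sum_(w in l) w = 0)%R.
  move: hl; rewrite inE.
  move=> /existsP[a /existsP[b /existsP[c /and3P[/eqP -> /= + /eqP abc]]]].
  rewrite !inE andbT => /andP[/norP[ab ac] bc].
  rewrite -setUA big_setU1 /=; last by rewrite !inE negb_or ab ac.
  by rewrite big_setU1 /= ?inE // big_set1 addrA.
move: suml; rewrite lE -setUA big_setU1 /=; last by rewrite !inE negb_or nuv eq_sym ku.
rewrite big_setU1 /= ?inE 1?eq_sym // big_set1 addrA => /eqP.
by rewrite addr_eq0 => /eqP ->; rewrite opprK.
Qed.

Lemma mem_AG_lines m (u v : 'cV['F_3]_m) :
  u != v -> [set u; v; (- (u + v))%R] \in AG_lines m.
Proof.
move=> nuv; rewrite inE; apply/existsP; exists u; apply/existsP; exists v.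
apply/existsP; exists (- (u + v))%R; rewrite eqxx subrr eqxx /= !inE negb_or nuv !andbT /=.
(* Moving terms across, [u = - (u + v)] becomes [v = - (u + u)], that is [v = u]; likewise for
   [v = - (u + v)]. *)
rewrite -!addr_eq0 addrA [(u + u + v)%R]addrC [(v + (u + v))%R]addrCA !addr_eq0.
by rewrite !F3_col_oppD eq_sym nuv.
Qed.

(** All nonzero entries of the codeword being 1, its product with [B] is the plain sum of the
    columns over its support. *)
Lemma code_triple_sum m N (B : 'M['F_3]_(m, N)) b :
  b \in code_triples (code (H_matrix B)) -> (\sum_(i in b) col i B = 0)%R.
Proof.
case/imsetP=> c; rewrite !inE => /and3P[Hc _ /forall_inP c1] ->.
move: Hc; rewrite /H_matrix mul_col_mx col_mx_eq0 => /andP[_ /eqP Bc].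
rewrite -[RHS]Bc; apply/matrixP=> i j; rewrite summxE mxE big_mkcond /=.
apply: eq_bigr => k _; rewrite !mxE ord1.
case: ifP => [kc|]; first by rewrite (eqP (c1 _ kc)) mulr1.
by rewrite inE => /negbFE/eqP ->; rewrite mulr0.
Qed.

Lemma sum0_triple_third m N (q : 'I_N -> 'cV['F_3]_m) (b : {set 'I_N}) x y :
  #|b| = 3 -> (\sum_(i in b) q i = 0)%R -> x \in b -> y \in b -> x != y ->
  exists2 k, b = [set x; y; k] & q k = (- (q x + q y))%R.
Proof.
move=> b3 + xb yb nxy.
have [k [-> kx ky]] := cards3_third b3 xb yb nxy.
rewrite -setUA big_setU1 /=; last by rewrite !inE negb_or nxy eq_sym kx.
rewrite big_setU1 /= ?inE 1?eq_sym // big_set1 addrA => /eqP.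
by rewrite addrC addr_eq0 => /eqP h; exists k; rewrite ?setUA.
Qed.

(** Selecting rows along an injective [f] is linear and onto, so its fibers are translates of the
    kernel; these [3 ^ m] fibers of equal size partition the [3 ^ n] vectors. *)
Lemma card_rowsub_fiber n m (f : 'I_m -> 'I_n) (u : 'cV['F_3]_m) :
  injective f ->
  3 ^ m * #|[set w : 'cV['F_3]_n | rowsub f w == u]| = 3 ^ n.
Proof.
move=> f_inj.
have fiber_card (v : 'cV['F_3]_m) : #|[set w : 'cV['F_3]_n | rowsub f w == v]|
    = #|[set w : 'cV['F_3]_n | rowsub f w == 0%R]|.
  (* A preimage of [v]: entry [v i] in row [f i], and 0 in the rows outside the image of [f]. *)
  pose s : 'cV['F_3]_n := (\col_k if [pick i | f i == k] is Some i then v i 0 else 0)%R.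
  have fs : rowsub f s = v.
    apply/matrixP=> i j; rewrite !mxE ord1; case: pickP => [k /eqP/f_inj -> //|].
    by move/(_ i); rewrite eqxx.
  rewrite -[RHS](card_imset _ (addrI s)); congr #|pred_of_set _|.
  apply/setP=> w; rewrite inE; apply/eqP/imsetP => [wv|[z + ->]].
    exists (w - s)%R; last by rewrite addrC subrK.
    by rewrite inE linearB /= fs wv subrr.
  by rewrite inE linearD /= fs => /eqP ->; rewrite addr0.
have cardc k : #|{: 'cV['F_3]_k}| = 3 ^ k by rewrite card_mx card_Fp // muln1.
rewrite -[RHS]cardc -[RHS]sum1_card (partition_big (rowsub f) predT) //= fiber_card.
rewrite -(cardc m) -sum_nat_const; apply: eq_bigr => v _.
by rewrite -(fiber_card v) -sum1_card; apply: eq_bigl => w; rewrite inE.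
Qed.

(** As [A] lists every vector once, [j |-> col j A] carries the group bijectively onto a fiber of
    the row selection. *)
Lemma card_point_group n t (B : 'M['F_3]_(n - t, 3 ^ n)) u :
  t <= n -> is_B_matrix B -> #|point_group B u| = 3 ^ t.
Proof.
move=> tn [A [f [A_bij f_incr BE]]].
have f_inj : injective f.
  move=> i j fij; apply/val_inj/eqP; case: ltngtP => // /f_incr;
    by rewrite fij ltnn.
have := card_rowsub_fiber u f_inj.
rewrite -[in RHS](subnK tn) expnD => /eqP.
rewrite eqn_pmul2l ?expn_gt0 // => /eqP <-.
rewrite -(card_imset _ (bij_inj A_bij)); congr #|pred_of_set _|.
have colE j : col j B = rowsub f (col j A) by rewrite BE; apply/matrixP=> i k; rewrite !mxE.
have [g _ gK] := A_bij.
apply/setP=> w; rewrite inE; apply/imsetP/eqP => [[j + ->]|wu].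
  by rewrite inE colE => /eqP.
by exists (g w); rewrite ?gK // inE colE gK wu.
Qed.

(** Count pairs [P \subset b] with [P] of size 2: each block contains three such [P], and each [P]
    lies in one block. *)
Lemma steiner_triple_system_card (V : finType) (X : {set V}) Bs :
  steiner_triple_system X Bs -> 6 * #|Bs| = #|X| * (#|X| - 1).
Proof.
move=> [hB hP].
have pairs : #|Bs| * 3 = 'C(#|X|, 2).
  rewrite -cards_draws -sum_nat_const -sum1_card.
  transitivity (\sum_(b in Bs)
      \sum_(P in [set P : {set V} | P \subset X & #|P| == 2]) (P \subset b : nat)).
    apply: eq_bigr => b /hB[bX b3].
    have <- : 'C(#|b|, 2) = 3 by rewrite b3.
    rewrite -cards_draws -sum1_card big_mkcond /=.
    rewrite [RHS]big_mkcond /=; apply: eq_bigr => P _; rewrite !inE.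
    case: (boolP (P \subset b)) => [Pb|_]; last by case: ifP.
    by rewrite (subset_trans Pb bX).
  rewrite exchange_big /=; apply: eq_bigr => P; rewrite inE => /andP[PX /eqP P2].
  rewrite -(hP P PX P2) -sum1_card [RHS]big_mkcond [LHS]big_mkcond /=.
  by apply: eq_bigr => b _; rewrite !inE; case: (b \in Bs); case: (P \subset b).
rewrite -[6]/(3 * 2) mulnC mulnA pairs subn1 -(ffactn1 #|X|.-1) -ffactnS.
exact: bin_ffact.
Qed.

(** Fix two groups [G] and [G']: each block contains exactly one pair of [setX G G'], and each such
    pair lies in one block. *)
Lemma transversal_design3_card (V : finType) g (Gs : {set {set V}}) Bs :
  transversal_design3 g Gs Bs -> #|Bs| = g * g.
Proof.
move=> [[Gs3 _] hG hB hP].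
have /card_gt1P[G [G' [GGs GGs' nGG']]] : 1 < #|Gs| by rewrite Gs3.
transitivity (\sum_(b in Bs) \sum_(p in setX G G') ((p.1 \in b) && (p.2 \in b) : nat)).
  rewrite -sum1_card; apply: eq_bigr => b /hB[_ hb].
  transitivity (#|b :&: G| * #|b :&: G'|); first by rewrite !hb.
  rewrite -cardsX -sum1_card.
  rewrite [LHS]big_mkcond [RHS]big_mkcond; apply: eq_bigr => -[x y] _ /=.
  by rewrite !inE /=; do 4 case: (_ \in _).
rewrite exchange_big /= -{1}(hG _ GGs) -(hG _ GGs') -cardsX -sum1_card.
apply: eq_bigr => -[x y] /setXP[/= xG yG].
rewrite -(hP G G' x y) // -sum1_card [RHS]big_mkcond [LHS]big_mkcond /=.
by apply: eq_bigr => b _; rewrite !inE; do 3 case: (_ \in _).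
Qed.

Theorem theorem3p8 (n t : nat) (hn : 2 <= n) (ht1 : 1 <= t) (htn : t <= n - 1)
    (B : 'M['F_3]_(n - t, 3 ^ n)) (hB : is_B_matrix B)
    (blocks : {set {set 'I_(3 ^ n)}})
    (hS : steiner_triple_system [set: 'I_(3 ^ n)] blocks)
    (hD : blocks \subset code_triples (code (H_matrix B))) :
  exists (Bpt : 'cV['F_3]_(n - t) -> {set {set 'I_(3 ^ n)}})
         (Bln : {set 'cV['F_3]_(n - t)} -> {set {set 'I_(3 ^ n)}}),
    (* the blocks are the disjoint union of the Bpt u and the Bln l *)
    [/\ blocks = (\bigcup_u Bpt u) :|: (\bigcup_(l in AG_lines (n - t)) Bln l),
        forall u v, u != v -> [disjoint Bpt u & Bpt v],
        forall l l', l \in AG_lines (n - t) -> l' \in AG_lines (n - t) ->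
          l != l' -> [disjoint Bln l & Bln l']
      & forall u l, l \in AG_lines (n - t) -> [disjoint Bpt u & Bln l]]
    /\ (forall u, 6 * #|Bpt u| = 3 ^ t * (3 ^ t - 1)
          /\ steiner_triple_system (point_group B u) (Bpt u))
    /\ (forall l, l \in AG_lines (n - t) ->
          #|Bln l| = 3 ^ (2 * t)
          /\ transversal_design3 (3 ^ t) [set point_group B u | u in l] (Bln l)).
Proof.
have tn : t <= n by rewrite (leq_trans htn) ?leq_subr.
pose q i := col i B.
have Gcard u : #|point_group B u| = 3 ^ t by apply: card_point_group.
have [hb hp] := hS.
have b3 b : b \in blocks -> #|b| = 3 by case/hb.
have third b x y : b \in blocks -> x \in b -> y \in b -> x != y ->
    exists2 k, b = [set x; y; k] & q k = (- (q x + q y))%R.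
  move=> bB; apply: sum0_triple_third; first exact: b3.
  by apply: code_triple_sum; apply: (subsetP hD).
(* Blocks are sorted by their image under [q]: a single point [u], or a line [l]. *)
pose Bpt u := [set b in blocks | b \subset point_group B u].
pose Bln (l : {set 'cV['F_3]_(n - t)}) := [set b in blocks | q @: b == l].
have inG u i : (i \in point_group B u) = (q i == u) by rewrite inE.
have imq x y k : q @: [set x; y; k] = [set q x; q y; q k].
  by rewrite !imsetU !imset_set1.
have ptS u : steiner_triple_system (point_group B u) (Bpt u).
  split=> [b|P PG P2]; first by rewrite inE => /andP[/b3].
  rewrite -[RHS](hp P (subsetT _) P2); congr #|pred_of_set _|.
  apply/setP=> b; rewrite !inE -andbA; case: (boolP (b \in blocks)) => //= bB.
  (* Any block through two points of the group of [u] stays inside it, so uniqueness is inherited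
     from the whole system. *)
  apply: andb_idl => Pb.
  have /cards2P[x [y [nxy PE]]] : #|P| == 2 by rewrite P2.
  have xP : x \in P by rewrite PE !inE eqxx.
  have yP : y \in P by rewrite PE !inE eqxx orbT.
  have := subsetP PG _ xP; have := subsetP PG _ yP; rewrite !inG => /eqP qy /eqP qx.
  have [k -> qk] := third _ _ _ bB (subsetP Pb _ xP) (subsetP Pb _ yP) nxy.
  apply/subsetP=> z; rewrite inG !inE => /orP[/orP[]|] /eqP ->; apply/eqP=> //.
  by rewrite qk qx qy F3_col_oppD.
have lnT l : l \in AG_lines (n - t) ->
    transversal_design3 (3 ^ t) [set point_group B u | u in l] (Bln l).
  move=> hl; have l3 := AG_line_card hl.
  have Gneq u v : point_group B u != point_group B v -> u != v.
    by apply: contraNneq => ->.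
  (* Groups are nonempty, and any member recovers its index through [q]; hence a line yields three
     distinct groups. *)
  have Ginj : injective (point_group B).
    move=> u v uv; have /card_gt0P[x xu] : 0 < #|point_group B u|.
      by rewrite Gcard expn_gt0.
    by move: (xu); rewrite uv !inG => /eqP <-; move: xu; rewrite inG => /eqP.
  split.
  - split; first by rewrite card_imset.
    apply/trivIsetP=> _ _ /imsetP[u _ ->] /imsetP[v _ ->] /Gneq nuv.
    rewrite -setI_eq0; apply/eqP/setP=> x; rewrite in_setI !inG in_set0.
    by apply: contraNF nuv => /andP[/eqP <- /eqP <-].
  - by move=> _ /imsetP[u _ ->].
  - move=> b; rewrite inE => /andP[bB /eqP ql]; split; first exact: b3.
    move=> _ /imsetP[u ul ->].
    (* [q] maps the 3-set [b] onto the 3-set [l], so it is injective on [b], and [b] meets each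
       group of [l] exactly once. *)
    have /imset_injP qinj : #|q @: b| == #|b| by rewrite ql l3 b3.
    move: ul; rewrite -ql => /imsetP[x xb ->].
    apply/eqP/cards1P; exists x; apply/setP=> z; rewrite in_setI inG in_set1.
    apply/andP/eqP => [[zb /eqP]|->]; last by rewrite xb eqxx.
    exact: qinj.
  - move=> _ _ x y /imsetP[u ul ->] /imsetP[v vl ->] /Gneq nuv.
    rewrite !inG => /eqP qx /eqP qy.
    have nxy : x != y by apply: contra nuv => /eqP xy; rewrite -qx -qy xy.
    rewrite -[RHS](hp [set x; y]) ?subsetT ?cards2 ?nxy //; congr #|pred_of_set _|.
    apply/setP=> b; rewrite !inE subUset !sub1set -andbA.
    (* A block through [x] and [y] has image [u], [v], [- (u + v)], which is all of [l]. *)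
    case: (boolP (b \in blocks)) => //= bB; apply: andb_idl => /andP[xb yb].
    have [k -> qk] := third _ _ _ bB xb yb nxy.
    by rewrite imq qk qx qy (AG_line_third hl ul vl nuv).
have ptim u b : b \in Bpt u -> q @: b = [set u].
  rewrite inE => /andP[bB /subsetP bG].
  have /card_gt0P[x xb] : 0 < #|b| by rewrite b3.
  apply/setP=> w; rewrite in_set1; apply/imsetP/eqP => [[y /bG + ->]|->].
    by rewrite inG => /eqP.
  by exists x => //; have := bG _ xb; rewrite inG => /eqP.
have disj (X Y : {set {set 'I_(3 ^ n)}}) : (forall b, b \in X -> b \in Y -> False) ->
    [disjoint X & Y].
  move=> h; rewrite -setI_eq0; apply/eqP/setP=> b; rewrite !inE.
  by apply/negP=> /andP[/h].
exists Bpt, Bln; split; last split.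
- split.
  + apply/setP=> b; rewrite inE; apply/idP/orP => [bB|];
      last by case=> /bigcupP[u _]; rewrite inE => /andP[].
    (* Two points of the block decide its kind: equal columns force the third to agree, distinct
       ones span a line. *)
    have /card_gt1P[x [y [xb yb nxy]]] : 1 < #|b| by rewrite b3.
    have [k bE qk] := third _ _ _ bB xb yb nxy.
    case: (eqVneq (q x) (q y)) => [qxy|nq].
      left; apply/bigcupP; exists (q x) => //; rewrite inE bB bE /=.
      apply/subsetP=> z; rewrite inG !inE => /orP[/orP[]|] /eqP -> //.
        by rewrite qxy.
      by rewrite qk -qxy F3_col_oppD.
    right; apply/bigcupP; exists [set q x; q y; (- (q x + q y))%R].
      exact: mem_AG_lines.
    by rewrite inE bB bE imq qk eqxx.
  + move=> u v nuv; apply: disj => b /ptim bu /ptim; rewrite bu => /set1_inj uv.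
    by rewrite uv eqxx in nuv.
  + move=> l l' _ _ nl; apply: disj => b; rewrite !inE => /andP[_ /eqP ->].
    by rewrite (negbTE nl) andbF.
  + move=> u l hl; apply: disj => b /ptim bu; rewrite inE bu => /andP[_ /eqP lE].
    by have := AG_line_card hl; rewrite -lE cards1.
- by move=> u; rewrite (steiner_triple_system_card (ptS u)) Gcard.
- move=> l hl; split; last exact: lnT.
  by rewrite (transversal_design3_card (lnT l hl)) mulnC expnM -mulnn -expnMn.
Qed.
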